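(* In the stratified setting below, define for each stratum $l$ the quantities $U_l^+,V_l^+,\eta_l^+,\nu_l^+$ and let $TE^+=\sum_{l=1}^L(U_l^+-\eta_l^+)$. If $TE^+\ge 1$, set for each $l$: $A_l=\min(U_l^+,\eta_l^+)$, $D_l=\min(\nu_l^+,V_l^+)$, $B_l=\min(U_l^+-A_l,\nu_l^+-D_l)$, $C_l=\min(\eta_l^+-A_l,V_l^+-D_l)$. If $TE^+<1$, set for each $l$: $B_l=\min(U_l^+,\nu_l^+)$, $C_l=\min(\eta_l^+,V_l^+)$. Then the maximum $\chi^+$ of $\chi(\mathbf a)$ over all feasible matchings equals $$\chi^+=\frac{\sum_{l=1}^L (B_l-C_l)-1}{\sqrt{\sum_{l=1}^L(B_l+C_l)+1}},$$ and it is attained by a feasible matching realizing these pair counts in each stratum.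
   Context: Stratified setting: there are $L$ strata. In stratum $l$ there are $N_l^t$ treated and $N_l^c$ control units, each with a binary outcome; $U_l$ is the number of treated units with outcome 1, $V_l=N_l^t-U_l$ the number of treated units with outcome 0, $\eta_l$ the number of control units with outcome 1, $\nu_l=N_l^c-\eta_l$ the number of control units with outcome 0. Let $M_l=\min(N_l^t,N_l^c)$. A feasible matching $\mathbf a$ is a set of disjoint treated–control pairs, each pair lying within a single stratum, each unit in at most one pair, with exactly $M_l$ pairs in stratum $l$ for every $l$. For a matching, $B(\mathbf a)$ is the number of pairs whose treated unit has outcome 1 and control unit has outcome 0, $C(\mathbf a)$ the number of pairs whose treated unit has outcome 0 and control unit has outcome 1, and $\chi(\mathbf a)=\frac{B(\mathbf a)-C(\mathbf a)-1}{\sqrt{B(\mathbf a)+C(\mathbf a)+1}}$. Truncated counts: $G_l^-=\max(N_l^t-N_l^c,0)$, $G_l^+=\max(N_l^c-N_l^t,0)$, $U_l^+=U_l-\max(U_l-N_l^c,0)$, $V_l^+=M_l-U_l^+$, $\eta_l^+=\max(\eta_l-G_l^+,0)$, $\nu_l^+=M_l-\eta_l^+$. *)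

(* Defs.v *)
From HB Require Import structures.
From mathcomp Require Import all_boot all_order all_algebra.
Set Implicit Arguments. Unset Strict Implicit. Unset Printing Implicit Defensive.
Import Order.TTheory GRing.Theory Num.Theory.

(* Stratified data: L strata indexed by 'I_L; stratum l has treated units
   'I_(Nt l) with binary outcomes yt l : 'I_(Nt l) -> bool and control units
   'I_(Nc l) with binary outcomes yc l. *)

Definition ones (n : nat) (y : 'I_n -> bool) : nat := #|[pred i | y i]|.
Definition zeros (n : nat) (y : 'I_n -> bool) : nat := #|[pred i | ~~ y i]|.

Definition matching (L : nat) (Nt Nc : 'I_L -> nat) :=
  forall l : 'I_L, {set 'I_(Nt l) * 'I_(Nc l)}.

Definition feasible (L : nat) (Nt Nc : 'I_L -> nat) (a : matching Nt Nc) : Prop :=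
  forall l : 'I_L,
    [/\ #|a l| = minn (Nt l) (Nc l),
        (forall p q, p \in a l -> q \in a l -> p.1 = q.1 -> p = q)
      & (forall p q, p \in a l -> q \in a l -> p.2 = q.2 -> p = q)].

Definition Bstrat (L : nat) (Nt Nc : 'I_L -> nat)
  (yt : forall l, 'I_(Nt l) -> bool) (yc : forall l, 'I_(Nc l) -> bool)
  (a : matching Nt Nc) (l : 'I_L) : nat :=
  #|[set p in a l | yt l p.1 && ~~ yc l p.2]|.
Definition Cstrat (L : nat) (Nt Nc : 'I_L -> nat)
  (yt : forall l, 'I_(Nt l) -> bool) (yc : forall l, 'I_(Nc l) -> bool)
  (a : matching Nt Nc) (l : 'I_L) : nat :=
  #|[set p in a l | ~~ yt l p.1 && yc l p.2]|.

Definition Bm L Nt Nc yt yc (a : matching Nt Nc) : nat :=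
  \sum_(l < L) @Bstrat L Nt Nc yt yc a l.
Definition Cm L Nt Nc yt yc (a : matching Nt Nc) : nat :=
  \sum_(l < L) @Cstrat L Nt Nc yt yc a l.

Definition chi_val (R : rcfType) (b c : nat) : R :=
  ((b%:Z - c%:Z - 1)%:~R) / Num.sqrt ((b + c + 1)%:R).

Definition chi (R : rcfType) L Nt Nc yt yc (a : matching Nt Nc) : R :=
  chi_val R (@Bm L Nt Nc yt yc a) (@Cm L Nt Nc yt yc a).

(* Truncated counts of a single stratum, from N^t, N^c, U (treated ones),
   eta (control ones).  Natural-number subtraction is truncated, so
   maxn (x - y) 0 = max(x - y, 0). *)
Definition Mst (Nt Nc : nat) := minn Nt Nc.
Definition Gminus (Nt Nc : nat) := maxn (Nt - Nc) 0.
Definition Gplus (Nt Nc : nat) := maxn (Nc - Nt) 0.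
Definition Uplus (Nt Nc U : nat) := U - maxn (U - Nc) 0.
Definition Vplus (Nt Nc U : nat) := Mst Nt Nc - Uplus Nt Nc U.
Definition etaplus (Nt Nc eta : nat) := maxn (eta - Gplus Nt Nc) 0.
Definition nuplus (Nt Nc eta : nat) := Mst Nt Nc - etaplus Nt Nc eta.

(* Target pair counts B_l, C_l, depending on whether TE^+ >= 1. *)
Definition Btarget (pos : bool) (Nt Nc U eta : nat) : nat :=
  let Up := Uplus Nt Nc U in let Vp := Vplus Nt Nc U in
  let ep := etaplus Nt Nc eta in let np := nuplus Nt Nc eta in
  if pos then
    let A := minn Up ep in let D := minn np Vp in minn (Up - A) (np - D)
  else minn Up np.
Definition Ctarget (pos : bool) (Nt Nc U eta : nat) : nat :=
  let Up := Uplus Nt Nc U in let Vp := Vplus Nt Nc U in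
  let ep := etaplus Nt Nc eta in let np := nuplus Nt Nc eta in
  if pos then
    let A := minn Up ep in let D := minn np Vp in minn (ep - A) (Vp - D)
  else minn ep Vp.

Definition TEplus L (Nt Nc : 'I_L -> nat)
  (yt : forall l, 'I_(Nt l) -> bool) (yc : forall l, 'I_(Nc l) -> bool) : int :=
  (\sum_(l < L) ((Uplus (Nt l) (Nc l) (ones (yt l)))%:Z
                 - (etaplus (Nt l) (Nc l) (ones (yc l)))%:Z))%R.

(* Main.v *)
Require Import Defs.
From HB Require Import structures.
From mathcomp Require Import all_boot all_order all_algebra.
From mathcomp Require Import zify ring lra.
Set Implicit Arguments. Unset Strict Implicit. Unset Printing Implicit Defensive.
Import Order.TTheory GRing.Theory Num.Theory.
Local Open Scope ring_scope.

(** In a stratum, a matching that uses [t] treated and [e] control units with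
    outcome 1 satisfies [B - C = t - e], where [t <= U^+] and [e >= eta^+].
    Hence [d = B - C] is at most [TE^+] in total, and [t = U^+], [e = eta^+]
    attains this.  If [TE^+ >= 1], then [chi = (d - 1) / sqrt ((d - 1) + 2 (C + 1))]
    is maximal when [d] is maximal and [C] minimal; otherwise
    [- chi = (1 - d) / sqrt ((1 - d) + 2 B)] is minimal when [d] and [B] are
    maximal.  In both cases the two optima are reached simultaneously. *)

(** * Monotonicity of the test statistic in the pair counts *)

Lemma ler_div_sqrtD (R : rcfType) (x y p q : R) :
  0 <= x -> x <= y -> 0 <= p -> p <= q ->
  x / Num.sqrt (q + x) <= y / Num.sqrt (p + y).
Proof.
move=> x0 xy p0 pq; have y0 := le_trans x0 xy.
have [x_gt0|] := ltP 0 x; last first.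
  (* The case [x = 0] is set apart because [q + x] or [p + y] may then vanish. *)
  move=> x_le0; have -> : x = 0 by apply/le_anti; rewrite x_le0.
  by rewrite mul0r divr_ge0 ?sqrtr_ge0.
have qx : 0 < q + x by lra.
have py : 0 < p + y by lra.
rewrite ler_pdivrMr ?sqrtr_gt0// mulrAC ler_pdivlMr ?sqrtr_gt0//.
rewrite -ler_sqr ?nnegrE ?mulr_ge0 ?sqrtr_ge0// !exprMn.
rewrite (sqr_sqrtr (ltW qx)) (sqr_sqrtr (ltW py)).
(* The squared goal [x ^+ 2 * (p + y) <= y ^+ 2 * (q + x)] is the sum of the two inequalities [px]
   and [xyx]. *)
have x2y2 : x ^+ 2 <= y ^+ 2 by rewrite ler_sqr ?nnegrE.
have px : x ^+ 2 * p <= y ^+ 2 * q by rewrite ler_pM ?exprn_ge0.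
have xyx : x * y * x <= x * y * y by rewrite ler_wpM2l ?mulr_ge0.
by lra.
Qed.

Lemma chi_val_le (R : rcfType) (b c b' c' : nat) :
  (b' + c <= b + c')%N -> (if (c < b)%N then (c <= c')%N else (b' <= b)%N) ->
  chi_val R b' c' <= chi_val R b c.
Proof.
rewrite /chi_val -(ler_nat R) !natrD !intrB -!pmulrn => bc.
have [b0 c0 b0' c0'] : [/\ 0 <= b%:R :> R, 0 <= c%:R :> R, 0 <= b'%:R :> R
  & 0 <= c'%:R :> R] by [].
case: ltnP; rewrite -!(ler_nat R) => cb H.
  rewrite -natr1 in cb.
  (* Since [c < b], the numerator [b - c - 1] is nonnegative, so a competitor with nonpositive
     numerator loses by sign alone; [ler_div_sqrtD] requires the other sign. *)
  have [n_le0|n_gt0] := leP (b'%:R - c'%:R - 1 : R) 0.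
    apply: (@le_trans _ _ 0); first by rewrite mulr_le0_ge0 ?invr_ge0 ?sqrtr_ge0.
    by rewrite divr_ge0 ?sqrtr_ge0//; lra.
  rewrite [in leLHS](_ : b'%:R + c'%:R + 1%:R = 2 * (c'%:R + 1) + (b'%:R - c'%:R - 1)); last ring.
  rewrite [in leRHS](_ : b%:R + c%:R + 1%:R = 2 * (c%:R + 1) + (b%:R - c%:R - 1)); last ring.
  by apply: ler_div_sqrtD; lra.
(* Negation makes the numerator [1 + c - b] positive and swaps the roles: [(b, c)] is now on the
   smaller side. *)
rewrite -lerN2 -!mulNr.
rewrite [in leLHS](_ : b%:R + c%:R + 1%:R = 2 * b%:R + - (b%:R - c%:R - 1)); last ring.
rewrite [in leRHS](_ : b'%:R + c'%:R + 1%:R = 2 * b'%:R + - (b'%:R - c'%:R - 1)); last ring.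
by apply: ler_div_sqrtD; lra.
Qed.

(** * Truncated counts and target pair counts *)

Local Open Scope nat_scope.

(** Only [Nc] controls are available, so this is the largest number of treated ones that can be
    matched. Dually, [etaplus] is the least number of matched control ones, as at most [Nc - Nt]
    controls stay unmatched. *)
Lemma UplusE (Nt Nc U : nat) : Uplus Nt Nc U = minn U Nc.
Proof. rewrite /Uplus; lia. Qed.

Lemma etaplusE (Nt Nc e : nat) : etaplus Nt Nc e = e - (Nc - Nt).
Proof. rewrite /etaplus /Gplus; lia. Qed.

Section Targets.
Variables (pos : bool) (Nt Nc U e : nat).
Hypotheses (U_le : U <= Nt) (e_le : e <= Nc).

Lemma Uplus_le : Uplus Nt Nc U <= Mst Nt Nc.
Proof. rewrite UplusE /Mst; lia. Qed.

Lemma etaplus_le : etaplus Nt Nc e <= Mst Nt Nc.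
Proof. rewrite etaplusE /Mst; lia. Qed.

(** Since [U^+ + V^+ = eta^+ + nu^+ = M], the differences [U^+ - eta^+] and [nu^+ - V^+] agree, so
    for [pos] both arguments of the minimum are the positive part of [U^+ - eta^+]. *)
Lemma BtargetE : Btarget pos Nt Nc U e =
  if pos then Uplus Nt Nc U - etaplus Nt Nc e
  else minn (Uplus Nt Nc U) (nuplus Nt Nc e).
Proof.
have := Uplus_le; have := etaplus_le; rewrite /Btarget /nuplus /Vplus.
case: pos => //; lia.
Qed.

Lemma CtargetE : Ctarget pos Nt Nc U e =
  if pos then etaplus Nt Nc e - Uplus Nt Nc U
  else minn (etaplus Nt Nc e) (Vplus Nt Nc U).
Proof.
have := Uplus_le; have := etaplus_le; rewrite /Ctarget /nuplus /Vplus.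
case: pos => //; lia.
Qed.

Lemma target_diff :
  Btarget pos Nt Nc U e + etaplus Nt Nc e = Ctarget pos Nt Nc U e + Uplus Nt Nc U.
Proof.
have := Uplus_le; have := etaplus_le; rewrite BtargetE CtargetE /nuplus /Vplus.
case: pos; lia.
Qed.

(** Ensures that the remaining cells [U^+ - B] and [M - U^+ - C] of the two-by-two table of pair
    types involve no truncation. *)
Lemma target_le :
  [/\ Btarget pos Nt Nc U e <= Uplus Nt Nc U,
      Ctarget pos Nt Nc U e <= etaplus Nt Nc e
    & Uplus Nt Nc U + Ctarget pos Nt Nc U e <= Mst Nt Nc].
Proof.
have := Uplus_le; have := etaplus_le; rewrite BtargetE CtargetE /Vplus.
by case: pos; split; lia.
Qed.

End Targets.

(** * Matchings inside one stratum *)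

Lemma ones_zeros (n : nat) (y : 'I_n -> bool) : ones y + zeros y = n.
Proof. by rewrite /ones /zeros -[RHS](card_ord n) -(cardC [pred i | y i]). Qed.

Lemma ones_le (n : nat) (y : 'I_n -> bool) : ones y <= n.
Proof. by rewrite -[leqRHS](ones_zeros y) leq_addr. Qed.

Lemma uniq_map_inj_in (T1 T2 : eqType) (f : T1 -> T2) (s : seq T1) :
  uniq (map f s) -> {in s &, injective f}.
Proof.
move=> us p q ps qs pq; rewrite -(nth_index p ps) -(nth_index p qs).
have index_map_f r : r \in s -> index r s = index (f r) (map f s).
  move=> rs; rewrite -{2}(nth_index r rs) -(nth_map r (f r)) ?index_mem//.
  by rewrite index_uniq ?size_map ?index_mem.
by rewrite !index_map_f// pq.
Qed.

Lemma count_zip (T1 T2 : Type) (P1 P2 : bool -> bool) (f1 : T1 -> bool) (f2 : T2 -> bool)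
    (b1 b2 : bool) (n : nat) (s : seq T1) (t : seq T2) :
  all (fun x => f1 x == b1) s -> all (fun x => f2 x == b2) t ->
  size s = n -> size t = n ->
  count (fun p => P1 (f1 p.1) && P2 (f2 p.2)) (zip s t) = (P1 b1 && P2 b2) * n.
Proof.
move=> + + <-; elim: s t => [|x s IHs] [|y t] //=; first by rewrite muln0.
by move=> /andP[/eqP-> s1] /andP[/eqP-> t1] [st]; rewrite IHs// mulnS.
Qed.

Section Stratum.
Variables (Nt Nc : nat) (yt : 'I_Nt -> bool) (yc : 'I_Nc -> bool).

(** The clause of [feasible] at a single stratum, so that strata can be treated independently. *)
Definition stratum_matching (S : {set 'I_Nt * 'I_Nc}) : Prop :=
  [/\ #|S| = minn Nt Nc,
      (forall p q, p \in S -> q \in S -> p.1 = q.1 -> p = q)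
    & (forall p q, p \in S -> q \in S -> p.2 = q.2 -> p = q)].

(** Let [A], [B], [C], [D] count the pairs with outcomes 11, 10, 01, 00. Disjointness of pairs gives
    [A + B <= ones yt] and [B + D <= zeros yc]; with total [M], the bounds follow by linear
    arithmetic. *)
Lemma stratum_matching_le S : stratum_matching S ->
  let B := #|[set p in S | yt p.1 && ~~ yc p.2]| in
  let C := #|[set p in S | ~~ yt p.1 && yc p.2]| in
  [/\ B + etaplus Nt Nc (ones yc) <= C + Uplus Nt Nc (ones yt),
      B <= Uplus Nt Nc (ones yt) & B <= nuplus Nt Nc (ones yc)].
Proof.
case=> cardS inj1 inj2 B C.
set A := #|[set p in S | yt p.1 && yc p.2]|.
set D := #|[set p in S | ~~ yt p.1 && ~~ yc p.2]|.
have split (P Q : pred ('I_Nt * 'I_Nc)) :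
    #|[set p in S | P p]| = #|[set p in S | P p && Q p]| + #|[set p in S | P p && ~~ Q p]|.
  rewrite -(cardsID [set p | Q p]); congr (_ + _);
    by apply: eq_card => p; rewrite !inE; case: (p \in S); case: (P p); case: (Q p).
have tE : #|[set p in S | yt p.1]| = A + B by exact: split.
have zE : #|[set p in S | ~~ yc p.2]| = B + D.
  rewrite (split _ (fun p => yt p.1)); congr (_ + _);
    by apply: eq_card => p; rewrite !inE; congr (_ && _); rewrite andbC.
have SE : #|S| = A + B + (C + D).
  rewrite -tE -(_ : #|[set p in S | ~~ yt p.1]| = C + D); last exact: split.
  have := split predT (fun p => yt p.1); rewrite /= => <-.
  by apply: eq_card => p; rewrite !inE andbT.
have t_le : A + B <= ones yt.
  rewrite -tE -(card_in_imset (f := fst)); last first.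
    by move=> p q; rewrite !inE => /andP[pS _] /andP[qS _]; exact: inj1.
  apply: subset_leq_card; apply/subsetP => i /imsetP[p].
  by rewrite !inE => /andP[_ yp] ->.
have z_le : B + D <= zeros yc.
  rewrite -zE -(card_in_imset (f := snd)); last first.
    by move=> p q; rewrite !inE => /andP[pS _] /andP[qS _]; exact: inj2.
  apply: subset_leq_card; apply/subsetP => i /imsetP[p].
  by rewrite !inE => /andP[_ yp] ->.
have := ones_zeros yt; have := ones_zeros yc.
rewrite /nuplus etaplusE UplusE /Mst.
split; lia.
Qed.

Lemma zip_stratum_matching (s : seq 'I_Nt) (t : seq 'I_Nc) :
  uniq s -> uniq t -> size s = size t -> size s = minn Nt Nc ->
  stratum_matching [set:: zip s t].
Proof.
move=> us ut st sM.
have uz : uniq (zip s t).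
  by apply: (@map_uniq _ _ fst); rewrite -/(unzip1 _) unzip1_zip ?st.
split.
- by rewrite cardsE (card_uniqP uz) size_zip -st minnn.
- move=> p q; rewrite !inE; apply: uniq_map_inj_in.
  by rewrite -/(unzip1 _) unzip1_zip ?st.
- move=> p q; rewrite !inE; apply: uniq_map_inj_in.
  by rewrite -/(unzip2 _) unzip2_zip ?st.
Qed.

Lemma card_zip (P : pred ('I_Nt * 'I_Nc)) (s : seq 'I_Nt) (t : seq 'I_Nc) :
  uniq s -> size s = size t -> #|[set p in [set:: zip s t] | P p]| = count P (zip s t).
Proof.
move=> us st.
have uz : uniq (zip s t).
  by apply: (@map_uniq _ _ fst); rewrite -/(unzip1 _) unzip1_zip ?st.
rewrite -size_filter -(card_uniqP (filter_uniq P uz)).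
by apply: eq_card => p; rewrite !inE mem_filter andbC.
Qed.

(** Any table of pair types fitting the available units is realized, by zipping lists of units cut
    into blocks of constant outcome. *)
Lemma exists_stratum_matching (A B C D : nat) :
  A + B <= ones yt -> C + D <= zeros yt -> A + C <= ones yc -> B + D <= zeros yc ->
  A + B + (C + D) = minn Nt Nc ->
  exists S, [/\ stratum_matching S,
    #|[set p in S | yt p.1 && ~~ yc p.2]| = B
    & #|[set p in S | ~~ yt p.1 && yc p.2]| = C].
Proof.
move=> t1_le t0_le c1_le c0_le M.
pose T1 := enum [pred i | yt i]; pose T0 := enum [pred i | ~~ yt i].
pose K1 := enum [pred i | yc i]; pose K0 := enum [pred i | ~~ yc i].
have sT1 : size T1 = ones yt by rewrite /T1 -cardE.
have sT0 : size T0 = zeros yt by rewrite /T0 -cardE.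
have sK1 : size K1 = ones yc by rewrite /K1 -cardE.
have sK0 : size K0 = zeros yc by rewrite /K0 -cardE.
have aT1 : all (fun i => yt i == true) T1.
  by apply/allP => i; rewrite mem_enum inE => ->.
have aT0 : all (fun i => yt i == false) T0.
  by apply/allP => i; rewrite mem_enum inE => /negPf->.
have aK1 : all (fun i => yc i == true) K1.
  by apply/allP => i; rewrite mem_enum inE => ->.
have aK0 : all (fun i => yc i == false) K0.
  by apply/allP => i; rewrite mem_enum inE => /negPf->.
have all_take T (P : pred T) n r : all P r -> all P (take n r).
  by rewrite -{1}(cat_take_drop n r) all_cat => /andP[].
have all_drop T (P : pred T) n r : all P r -> all P (drop n r).
  by rewrite -{1}(cat_take_drop n r) all_cat => /andP[].
have uniq_cat2 n (y : 'I_n -> bool) (i j : nat) :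
    uniq (take i (enum [pred k | y k]) ++ take j (enum [pred k | ~~ y k])).
  rewrite cat_uniq !take_uniq ?enum_uniq// andbT.
  apply/hasPn => k /mem_take; rewrite mem_enum inE => yk.
  by apply/negP => /mem_take; rewrite mem_enum inE (negPf yk).
(* Aligned blocks of lengths [A], [B], [C], [D]: treated outcomes 1, 1, 0, 0 in [s] face control
   outcomes 1, 0, 1, 0 in [t]. *)
pose s := (take A T1 ++ take B (drop A T1)) ++ (take C T0 ++ take D (drop C T0)).
pose t := (take A K1 ++ take B K0) ++ (take C (drop A K1) ++ take D (drop B K0)).
have us : uniq s by rewrite /s -!takeD uniq_cat2.
have ut : uniq t.
  (* Exchanging the two middle blocks of [t] collects the ones before the zeros. *)
  have /perm_uniq-> : perm_eq t (take (A + C) K1 ++ take (B + D) K0).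
    by rewrite !takeD; apply/permPl; exact: perm_catACA.
  exact: uniq_cat2.
have sz : [/\ size (take A T1) = A, size (take B (drop A T1)) = B,
    size (take C T0) = C & size (take D (drop C T0)) = D].
  by rewrite !size_take_min !size_drop sT1 sT0; split; lia.
have tz : [/\ size (take A K1) = A, size (take B K0) = B,
    size (take C (drop A K1)) = C & size (take D (drop B K0)) = D].
  by rewrite !size_take_min !size_drop sK1 sK0; split; lia.
case: sz tz => sA sB sC sD [tA tB tC tD].
have ss : size s = A + B + (C + D) by rewrite !size_cat sA sB sC sD.
have st : size t = A + B + (C + D) by rewrite !size_cat tA tB tC tD.
have count_st P1 P2 : count (fun p => P1 (yt p.1) && P2 (yc p.2)) (zip s t) =
    (P1 true && P2 true) * A + (P1 true && P2 false) * B +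
    ((P1 false && P2 true) * C + (P1 false && P2 false) * D).
  rewrite !zip_cat ?size_cat ?sA ?sB ?sC ?sD ?tA ?tB ?tC ?tD// !count_cat.
  by congr (_ + _ + (_ + _)); apply: (count_zip P1 P2); auto.
exists [set:: zip s t]; split.
- by apply: zip_stratum_matching; rewrite ?ss ?st.
- by rewrite card_zip ?ss// (count_st id negb) /=; lia.
- by rewrite card_zip ?ss// (count_st negb id) /=; lia.
Qed.
End Stratum.

(** * Assembling the strata *)

Local Open Scope ring_scope.

Theorem theorem6 (R : rcfType) (L : nat) (Nt Nc : 'I_L -> nat)
  (yt : forall l, 'I_(Nt l) -> bool) (yc : forall l, 'I_(Nc l) -> bool) :
  let pos := (1 <= TEplus yt yc) in
  let Bl := fun l : 'I_L =>
    Btarget pos (Nt l) (Nc l) (ones (yt l)) (ones (yc l)) in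
  let Cl := fun l : 'I_L =>
    Ctarget pos (Nt l) (Nc l) (ones (yt l)) (ones (yc l)) in
  let chiplus : R := chi_val R (\sum_(l < L) Bl l)%N (\sum_(l < L) Cl l)%N in
  (forall a : matching Nt Nc, feasible a -> chi R yt yc a <= chiplus) /\
  (exists a : matching Nt Nc,
     [/\ feasible a,
         (forall l, Bstrat yt yc a l = Bl l),
         (forall l, Cstrat yt yc a l = Cl l)
       & chi R yt yc a = chiplus]).
Proof.
move=> pos Bl Cl chiplus; split=> [a fa|].
  have bound l := stratum_matching_le (yt l) (yc l) (fa l).
  apply: chi_val_le.
    rewrite /Bm /Cm -!big_split; apply: leq_sum => l _.
    have [] := bound l; have := target_diff pos (ones_le (yt l)) (ones_le (yc l)).
    rewrite -/(Bl l) -/(Cl l) /Bstrat /Cstrat /=; lia.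
  (* Summing [target_diff] shows that the targets have total difference [TEplus], so the case split
     of [chi_val_le] is exactly the test [1 <= TEplus]. *)
  have -> : (\sum_(l < L) Cl l < \sum_(l < L) Bl l)%N = pos.
    have TE : (TEplus yt yc = (\sum_(l < L) Bl l)%N%:Z - (\sum_(l < L) Cl l)%N%:Z).
      rewrite /TEplus !(big_morph Posz PoszD (erefl _)) -sumrB.
      apply: eq_bigr => l _; have := target_diff pos (ones_le (yt l)) (ones_le (yc l)).
      rewrite -/(Bl l) -/(Cl l); lia.
    rewrite /pos; lia.
  case E : pos; apply: leq_sum => l _; have [] := bound l.
    rewrite /Cl E (CtargetE _ (ones_le _) (ones_le _)) /Cstrat; lia.
  by rewrite /Bl E (BtargetE _ (ones_le _) (ones_le _)) /Bstrat leq_min => _ -> ->.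
have /fin_all_exists[a aP] : forall l, exists S, [/\ stratum_matching S,
    #|[set p in S | yt l p.1 && ~~ yc l p.2]| = Bl l
    & #|[set p in S | ~~ yt l p.1 && yc l p.2]| = Cl l].
  move=> l; have D := target_diff pos (ones_le (yt l)) (ones_le (yc l)).
  have [BU Ce M] := target_le pos (ones_le (yt l)) (ones_le (yc l)).
  have := ones_zeros (yt l); have := ones_zeros (yc l).
  rewrite -/(Bl l) -/(Cl l) etaplusE UplusE /Mst in D BU Ce M * => zc zt.
  (* The cells [A = U^+ - B] and [D = M - U^+ - C] make the matching use exactly [U^+] treated ones
     and, by [target_diff], [eta^+] control ones. *)
  apply: (@exists_stratum_matching _ _ _ _ (minn (ones (yt l)) (Nc l) - Bl l)%N
    _ _ (minn (Nt l) (Nc l) - minn (ones (yt l)) (Nc l) - Cl l)%N); lia.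
exists a; split=> [l|l|l|]; try by case: (aP l).
by rewrite /chi /chiplus; congr (chi_val R _ _); apply: eq_bigr => l _; case: (aP l).
Qed.
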